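(* Let $f : \mathbb{T} \to \mathbb{R}$ be any continuous function, let $\alpha \in \mathbb{R}$ with $\alpha \neq 0$, let $\theta \in \mathbb{R}$, and let $\rho > 0$ be a real number that is not an integer. Define the potential $V : \mathbb{N} \to \mathbb{R}$ by $$V(n) = f(\alpha n^{\rho} + \theta).$$ Then $$\sigma(V) = [\min(f) - 2, \max(f) + 2].$$
   Context: $\mathbb{N} = \{1, 2, 3, \dots\}$ and $\mathbb{T} = \mathbb{R}/\mathbb{Z}$ is the circle; for real $t$, $f(t)$ means $f$ evaluated at the class of $t$ modulo $1$. For a bounded sequence $V : \mathbb{N} \to \mathbb{R}$, the Schrödinger operator $H_V$ on $\ell^2(\mathbb{N})$ is defined for $u \in \ell^2(\mathbb{N})$ by $$(H_V u)(n) = u(n+1) + u(n-1) + V(n) u(n) \quad (n \geq 2), \qquad (H_V u)(1) = u(2) + V(1) u(1).$$ $\sigma(V)$ denotes the spectrum of the operator $H_V$. *)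

(* Defs.v *)
From HB Require Import structures.
From mathcomp Require Import all_boot all_order all_algebra.
From mathcomp Require Import generic_quotient complex.
From mathcomp Require Import all_classical all_reals all_analysis.
Set Implicit Arguments.
Unset Strict Implicit.
Unset Printing Implicit Defensive.
Import Order.TTheory GRing.Theory Num.Theory.
Import numFieldNormedType.Exports.
Local Open Scope classical_set_scope.
Local Open Scope ring_scope.
Local Open Scope quotient_scope.
Local Open Scope complex_scope.

Section Circle.
Variable R : realType.

Definition eqmod1 (x y : R) : bool := (x - y) \is a Num.int.

Lemma eqmod1_equiv : equiv_class_of eqmod1.
Proof.
split=> [x|x y|y x z]; rewrite /eqmod1 ?subrr ?rpred0 //.
  by rewrite -opprB rpredN.
by move=> xy yz; rewrite -(subrKA y) rpredD.
Qed.

Canonical eqmod1_rel := EquivRelPack eqmod1_equiv.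

(* R / Z with the quotient topology. *)
Definition circle : Type := quotient_topology {eq_quot eqmod1_rel}.
HB.instance Definition _ := Topological.on circle.

Definition to_circle (t : R) : circle := \pi_{eq_quot eqmod1_rel} t.

End Circle.

Definition is_min (T : Type) (R : realType) (f : T -> R) (m : R) : Prop :=
  range f m /\ lbound (range f) m.

Definition is_max (T : Type) (R : realType) (f : T -> R) (M : R) : Prop :=
  range f M /\ ubound (range f) M.

(* With N = {1, 2, 3, ...}, a sequence u on N is represented by the function  *)
(* nat -> _ whose value at k is u(k + 1); thus index 0 is the first site.     *)
Section SquareSummable.
Variable R : realType.
Implicit Types (u v : nat -> R[i]) (T : (nat -> R[i]) -> (nat -> R[i])).

Definition l2norm_sq u : \bar R :=
  (\sum_(0 <= k <oo) ((ComplexField.Normc.normc (u k)) ^+ 2)%:E)%E.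

Definition ell2 : set (nat -> R[i]) := [set u | (l2norm_sq u < +oo)%E].

Definition l2norm u : R := Num.sqrt (fine (l2norm_sq u)).

(* Operators on ell2 are represented by maps on all sequences; only their     *)
(* restriction to ell2 is ever constrained.                                   *)
Definition bounded_operator T : Prop :=
  [/\ forall u, ell2 u -> ell2 (T u),
      forall (a : R[i]) u v, ell2 u -> ell2 v ->
        T (fun k => a * u k + v k) = (fun k => a * T u k + T v k) &
      exists c : R, forall u, ell2 u -> l2norm (T u) <= c * l2norm u].

Definition resolvent_set T : set R[i] := [set z | exists S,
  [/\ bounded_operator S,
      forall u, ell2 u -> S (fun k => T u k - z * u k) = u &
      forall u, ell2 u -> (fun k => T (S u) k - z * S u k) = u]].

Definition spectrum T : set R[i] := ~` resolvent_set T.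

Definition schrodinger (V : nat -> R) u : nat -> R[i] := fun k =>
  if k is j.+1 then u j.+2 + u j + (V j.+1)%:C * u j.+1
  else u 1%N + (V 0%N)%:C * u 0%N.

End SquareSummable.

(* Main.v *)
(** Write [k] for the integer part of [rho].  The [k]-th forward difference of
[alpha * n ^ rho] diverges slowly, i.e. its increments tend to 0, so modulo 1 it
stays near any prescribed point along arbitrarily long blocks.  This property passes from a difference
sequence to the sequence itself: where the difference stays near a small
[gamma > 0] modulo 1, the sequence turns slowly around the circle.  Hence [V] is
almost equal to any given value of [f] along arbitrarily long blocks, and plane
waves cut off to these blocks are approximate eigenvectors for every energy of
[[min f - 2, max f + 2]].

Conversely, centre [V] at [c], with [|V - c| <= r].  As [H - c] is symmetric of
norm at most [2 + r], the norm of [H - (c + i t)] is at most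
[sqrt ((2 + r) ^ 2 + t ^ 2)], and each [z] outside the interval is, for some real
[t], further than that from [c + i t].  The Neumann series then inverts
[H - z]. *)

Require Import Defs.
From HB Require Import structures.
From mathcomp Require Import all_boot all_order all_algebra.
From mathcomp Require Import generic_quotient complex.
From mathcomp Require Import all_classical all_reals all_analysis.
From mathcomp Require Import zify ring lra.
Set Implicit Arguments.
Unset Strict Implicit.
Unset Printing Implicit Defensive.
Import Order.TTheory GRing.Theory Num.Theory.
Import numFieldNormedType.Exports.
Local Open Scope classical_set_scope.
Local Open Scope ring_scope.
Local Open Scope complex_scope.

(** * Long blocks on which a sequence is almost constant modulo 1 *)

Section Hitting.
Variable R : realType.
Implicit Types (g h : nat -> R).

Definition forward_diff g (n : nat) : R := g n.+1 - g n.

(** The integer [p] may change with [i], so closeness is measured on the circle. Single visits near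
    [beta] would give only density modulo 1; the plane waves need whole blocks. *)
Definition block_dense g : Prop :=
  forall (beta delta : R) (L : nat), 0 < delta ->
  exists n : nat, forall i, (i <= L)%N ->
  exists p : int, `|g (n + i)%N - beta - p%:~R| <= delta.

(** At the first index where [h] reaches [beta] the overshoot is at most one step [eta]; the next
    [L] steps drift by at most [eta] each. Hence the factor [L.+1]. *)
Lemma slow_hit h (beta eta : R) (m L : nat) : 0 <= eta ->
  (forall j, (j < m + L)%N -> `|h j.+1 - h j| <= eta) ->
  h 0%N <= beta -> beta <= h m ->
  exists j, forall i, (i <= L)%N -> `|h (j + i)%N - beta| <= eta * L.+1%:R.
Proof.
move=> eta0 hstep h0 hm.
have exP : exists j, beta <= h j by exists m.
case: (ex_minnP exP) => j hj jmin.
have jm : (j <= m)%N by exact: jmin.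
have hjb : `|h j - beta| <= eta.
  case: j hj jmin jm => [|j] hj jmin jm; first by rewrite ger0_norm; lra.
  have hj' : h j < beta by rewrite ltNge; apply/negP => /jmin; rewrite ltnn.
  have := hstep j (leq_trans jm (leq_addr _ _)).
  by rewrite ler_norml ger0_norm; lra.
exists j => i iL.
have : `|h (j + i)%N - beta| <= eta * i.+1%:R.
  elim: i iL => [|i IH] iL; first by rewrite addn0 mulr1.
  have hs : `|h (j + i).+1 - h (j + i)%N| <= eta by apply: hstep; lia.
  have -> : h (j + i.+1)%N - beta =
     (h (j + i).+1 - h (j + i)%N) + (h (j + i)%N - beta) by rewrite addnS; ring.
  apply: (le_trans (ler_normD _ _)).
  by rewrite -[in _%:R]addn1 natrD mulrDr mulr1 addrC lerD// IH// ltnW.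
by move/le_trans; apply; rewrite ler_wpM2l// ler_nat ltnS.
Qed.

Lemma block_dense_slow g : g @ \oo --> +oo -> forward_diff g @ \oo --> 0 ->
  block_dense g.
Proof.
move=> /cvgryPge goo /cvgr0Pnorm_le dg0 beta delta L delta0.
have eta0 : 0 < delta / L.+1%:R by rewrite divr_gt0.
have [N _ HN] := dg0 _ eta0.
(* The translate [beta + p] lies above [g N], and [g], being unbounded, must cross it after [N],
   where all steps are small. *)
pose p := Num.ceil (g N - beta).
have [M _ HM] := goo (beta + p%:~R).
have h0 : g (N + 0)%N <= beta + p%:~R.
  by rewrite addn0 -lerBlDl; exact: ceil_ge.
have hm : beta + p%:~R <= g (N + M)%N by apply: HM => /=; rewrite leq_addl.
have [|j Hj] := slow_hit (h := fun j => g (N + j)%N) (L := L) (ltW eta0) _ h0 hm.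
  by move=> j _; rewrite addnS; apply: HN => /=; rewrite leq_addr.
exists (N + j)%N => i iL; exists p.
by rewrite -addnA -addrA -opprD (le_trans (Hj i iL))// mulfVK.
Qed.

(* If [forward_diff g] stays mod 1 in [gamma / 2, 3 gamma / 2] along a long
   block, then [g] itself turns slowly around the whole circle along it. *)
Lemma block_dense_diff g : block_dense (forward_diff g) -> block_dense g.
Proof.
move=> dg beta delta L delta0.
(* The steps of the lifted sequence will be at most [3 * gamma / 2], so [L.+1] of them add up to
   [3 / 4 * delta]. *)
pose gamma := delta / (2 * L.+1%:R).
have L0 : (0 : R) < L.+1%:R by [].
have gamma0 : 0 < gamma by rewrite divr_gt0// mulr_gt0.
(* With steps of at least [gamma / 2], [m] steps make at least one full turn. *)
pose m := (Num.truncn (2 / gamma)).+1.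
have mgamma : 1 <= m%:R * (gamma / 2).
  have : 2 / gamma <= m%:R by apply/ltW/truncnS_gt.
  by rewrite ler_pdivrMr// => H; lra.
have [|n Hn] := dg gamma (gamma / 2) (m + L)%N; first by rewrite divr_gt0.
have /choice[p Hp] : forall i, exists p : int, (i <= m + L)%N ->
    `|forward_diff g (n + i) - gamma - p%:~R| <= gamma / 2.
  move=> i; have [/Hn[p Hp]|_] := leqP i (m + L)%N; first by exists p.
  by exists 0.
(* Subtracting the accumulated integers leaves [g] unchanged modulo 1 and turns its increments into
   small positive reals. *)
pose P j : int := \sum_(i < j) p i.
pose h j : R := g (n + j)%N - (P j)%:~R.
have hS j : h j.+1 - h j = forward_diff g (n + j) - (p j)%:~R.
  by rewrite /h /P big_ord_recr/= rmorphD/= addnS /forward_diff; ring.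
have hstep j : (j <= m + L)%N -> gamma / 2 <= h j.+1 - h j <= 3 * gamma / 2.
  by move=> /Hp; rewrite hS ler_norml; lra.
have hgrow j : (j <= m)%N -> h 0%N + j%:R * (gamma / 2) <= h j.
  elim: j => [|j IH] jm; first by lra.
  have := IH (ltnW jm); have /andP[] := hstep j (leq_trans (ltnW jm) (leq_addr _ _)).
  by rewrite -[in _%:R]addn1 natrD; lra.
(* The translate [beta + q] lies in [[h 0, h 0 + 1)], so [h] crosses it within [m] steps. *)
pose q := Num.ceil (h 0%N - beta).
have /andP[q1 q2] := ceil_itv (h 0%N - beta).
rewrite -/q intrB in q1 q2.
have [||||j Hj] := @slow_hit h (beta + q%:~R) (3 * gamma / 2) m L.
- by rewrite divr_ge0// mulr_ge0// ltW.
- by move=> j /ltnW/hstep/andP[a b]; rewrite ler_norml; lra.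
- by lra.
- by have := hgrow m (leqnn m); lra.
exists (n + j)%N => i iL; exists (q + P (j + i)%N).
rewrite rmorphD/=.
have -> : g (n + j + i)%N - beta - (q%:~R + (P (j + i)%N)%:~R) =
  h (j + i)%N - (beta + q%:~R) by rewrite /h -addnA; ring.
apply: (le_trans (Hj i iL)).
have -> : 3 * gamma / 2 * L.+1%:R = 3 / 4 * delta.
  by rewrite /gamma; field; rewrite -natr1 in L0; rewrite lt0r_neq0.
by lra.
Qed.

Lemma block_dense_iter g k : iter k forward_diff g @ \oo --> +oo ->
  iter k.+1 forward_diff g @ \oo --> 0 -> block_dense g.
Proof.
move=> goo dg0; have := block_dense_slow goo dg0.
elim: k {goo dg0} => // k IH /=.
by move/block_dense_diff/IH.
Qed.

Lemma block_denseN g : block_dense (\- g) -> block_dense g.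
Proof.
move=> gd beta delta L /gd => /(_ (- beta) L)[n Hn]; exists n => i /Hn[p Hp].
exists (- p); rewrite -normrN rmorphN/=; congr (`|_| <= _) : Hp.
by rewrite /=; ring.
Qed.

(** * Iterated differences of real powers *)

Lemma iter_diff_MVT (G : nat -> R -> R) (k n : nat) :
  (forall i (x : R), 0 < x -> is_derive x 1 (G i) (G i.+1 x)) ->
  exists2 xi, n.+1%:R <= xi &
    iter k forward_diff (fun j => G 0%N j.+1%:R) n = G k xi.
Proof.
elim: k G => [|k IH] G dG; first by exists n.+1%:R.
(* [D] is again a chain of successive derivatives. The induction hypothesis for [D] leaves a single
   difference of [G k], to which the mean value theorem applies. *)
pose D i x := G i (x + 1) - G i x.
have dD i (x : R) : 0 < x -> is_derive x 1 (D i) (D i.+1 x).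
  move=> x0.
  have d1 := dG i x x0.
  have d2 : is_derive (x + 1) 1 (G i) (G i.+1 (x + 1)).
    by apply: dG; rewrite addr_gt0.
  rewrite /D; apply: is_deriveB.
  have := @is_derive1_comp R (G i) (fun x => x + 1) x (G i.+1 (x + 1)) 1 d2.
  by rewrite mulr1; apply; apply: is_derive_eq; rewrite addr0.
have [xi nxi Hxi] := IH D dD.
have xi0 : 0 < xi by apply: lt_le_trans nxi.
have [|||c] := @MVT_segment R (G k) (G k.+1) xi (xi + 1).
- by rewrite lerDl.
- by move=> x; rewrite in_itv/= => /andP[x1 _]; apply/dG/(lt_trans xi0).
- apply: derivable_within_continuous => x; rewrite in_itv/= => /andP[x1 _].
  by apply: ex_derive; apply/dG/(lt_le_trans xi0).
rewrite in_itv/= => /andP[xic _] Hc.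
exists c; first exact: le_trans xic.
rewrite -iterS iterSr.
have -> : forward_diff (fun j => G 0%N j.+1%:R) = (fun j => D 0%N j.+1%:R).
  by apply/funext => j; rewrite /forward_diff /D natr1.
by rewrite Hxi /D Hc; ring.
Qed.

(** Uniformity in [x] matters because the mean value points [xi] are known only to be at least
    [n.+1]. *)
Lemma near_powR_ge (r A : R) : 0 < r -> \forall n \near \oo,
  forall x, n.+1%:R <= x -> A <= x `^ r.
Proof.
move=> r0; near=> n => x nx.
have Ax : `|A| `^ r^-1 <= x.
  apply: le_trans nx; rewrite -natr1 ler_wpDr//.
  by near: n; exact: nbhs_infty_ger.
rewrite (le_trans (ler_norm A))//.
have -> : `|A| = (`|A| `^ r^-1) `^ r.
  by rewrite -powRrM mulVf ?gt_eqF// powRr1.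
by apply: (ge0_ler_powR (ltW r0)); rewrite ?nnegrE ?powR_ge0// (le_trans _ Ax)// powR_ge0.
Unshelve. all: by end_near. Qed.

Lemma block_dense_powR (alpha rho : R) : alpha != 0 -> 0 < rho ->
  rho \isn't a Num.int -> block_dense (fun n => alpha * n.+1%:R `^ rho).
Proof.
wlog alpha0 : alpha / 0 < alpha.
  move=> H a0 r0 ri; have [/H|aneg|a00] := ltgtP 0 alpha; first exact.
    apply: block_denseN.
    have -> : (\- (fun n => alpha * n.+1%:R `^ rho)) =
              (fun n : nat => (- alpha) * n.+1%:R `^ rho).
      by apply/funext => n /=; rewrite mulNr.
    by apply: H => //; rewrite ?oppr_gt0// oppr_eq0.
  by rewrite -a00 eqxx in a0.
move=> _ rho0 rhoN.
(* Falling factorials: [G i] is the [i]-th derivative of [alpha * x ^ rho]. *)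
pose c i : R := alpha * \prod_(j < i) (rho - j%:R).
pose G i (x : R) := c i * x `^ (rho - i%:R).
have dG i (x : R) : 0 < x -> is_derive x 1 (G i) (G i.+1 x).
  move=> x0; have d := is_derive1_powR (rho - i%:R) x0.
  apply: is_derive_eq.
  rewrite /G /c big_ord_recr/= -natr1 opprD addrA /GRing.scale/=.
  by ring.
have G0 : (fun n => alpha * n.+1%:R `^ rho) = (fun n => G 0%N n.+1%:R).
  by apply/funext => n; rewrite /G /c big_ord0 mulr1 subr0.
pose k := Num.truncn rho.
have /andP[k1 k2] := truncn_itv (ltW rho0); rewrite -/k in k1 k2.
(* Here [rho] being no integer enters: the exponent [rho - k] is positive, so the [k]-th differences
   diverge, while [rho - k.+1] is negative, so the next ones tend to 0. *)
have klt : k%:R < rho.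
  rewrite lt_neqAle k1 andbT; apply: contra rhoN => /eqP <-.
  exact: intr_nat.
have ck : 0 < c k.
  rewrite mulr_gt0// prodr_gt0// => j _; rewrite subr_gt0.
  by rewrite (lt_trans _ klt)// ltr_nat.
rewrite G0; apply: (@block_dense_iter _ k).
  apply/cvgryPge => A.
  have [N _ HN] := near_powR_ge (A / c k) (r := rho - k%:R) ltac:(by rewrite subr_gt0).
  exists N => // n /= Nn.
  have [xi nxi ->] := iter_diff_MVT k n dG.
  by rewrite /G mulrC -ler_pdivrMr//; exact: HN nxi.
apply/cvgr0Pnorm_le => e e0.
have [N _ HN] := near_powR_ge (`|c k.+1| / e) (r := k.+1%:R - rho) ltac:(by rewrite subr_gt0).
exists N => // n /= Nn.
rewrite -iterS.
have [xi nxi ->] := iter_diff_MVT k.+1 n dG.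
have xi0 : 0 < xi by apply: lt_le_trans nxi.
rewrite /G -opprB powRN normrM normfV (ger0_norm (powR_ge0 _ _)) ler_pdivrMr ?powR_gt0//.
by rewrite mulrC -ler_pdivrMr//; exact: HN nxi.
Qed.

End Hitting.

(** * Square summable sequences and Neumann series *)

Section SquareSums.
Variable R : realType.
Local Notation C := R[i].
Local Notation Re := complex.Re.
Local Notation Im := complex.Im.
Implicit Types (x y z : C) (u v : nat -> C).

Definition sqnorm z : R := Re z ^+ 2 + Im z ^+ 2.

Definition sqsum (N : nat) u : R := \sum_(k < N) sqnorm (u k).

(** All estimates are made on finite sums; [sqbounded_ell2] and [ell2_sqbounded] translate to and
    from the extended real series. *)
Definition sqbounded u (c : R) : Prop := forall N, sqsum N u <= c.

Lemma sqnorm_ge0 z : 0 <= sqnorm z.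
Proof. by rewrite addr_ge0// sqr_ge0. Qed.

Lemma normc_sqr z : ComplexField.Normc.normc z ^+ 2 = sqnorm z.
Proof. by case: z => a b; rewrite /= sqr_sqrtr// addr_ge0// sqr_ge0. Qed.

Lemma sqnormM x y : sqnorm (x * y) = sqnorm x * sqnorm y.
Proof. by case: x y => [a b] [c d]; rewrite /sqnorm/=; ring. Qed.

Lemma sqnorm1 : sqnorm 1 = 1.
Proof. by rewrite /sqnorm/= expr0n addr0 expr1n. Qed.

Lemma sqnorm0 : sqnorm 0 = 0.
Proof. by rewrite /sqnorm/= expr0n addr0. Qed.

Lemma sqnormX z n : sqnorm (z ^+ n) = sqnorm z ^+ n.
Proof. by elim: n => [|n IH]; rewrite ?expr0 ?sqnorm1// !exprS sqnormM IH. Qed.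

Lemma sqnormV z : sqnorm z^-1 = (sqnorm z)^-1.
Proof. by rewrite -!normc_sqr ComplexField.Normc.normcV exprVn. Qed.

Lemma sqnorm_eq0 z : (sqnorm z == 0) = (z == 0).
Proof. by rewrite paddr_eq0 ?sqr_ge0// !sqrf_eq0 eq_complex. Qed.

Lemma sqnorm_real (a : R) : sqnorm a%:C = a ^+ 2.
Proof. by rewrite /sqnorm/= expr0n addr0. Qed.

(** Young's inequality: the difference of the two sides is [s^-1] times the squared modulus of
    [x - s * y]. The weight [s] is free so that the coefficient of [y] can be brought near 1. *)
Lemma sqnormD_le x y (s : R) : 0 < s ->
  sqnorm (x + y) <= (1 + s^-1) * sqnorm x + (1 + s) * sqnorm y.
Proof.
move=> s0; rewrite -subr_ge0.
have -> : (1 + s^-1) * sqnorm x + (1 + s) * sqnorm y - sqnorm (x + y) =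
  s^-1 * ((Re x - s * Re y) ^+ 2 + (Im x - s * Im y) ^+ 2).
  case: x y => [a b] [c d]; rewrite /sqnorm/=; field.
  exact: lt0r_neq0.
by rewrite mulr_ge0 ?invr_ge0 ?(ltW s0)// addr_ge0// sqr_ge0.
Qed.

Lemma sqsum0 N : sqsum N (fun=> 0) = 0.
Proof. by rewrite /sqsum big1// => k _; exact: sqnorm0. Qed.

Lemma sqsumS N u : sqsum N.+1 u = sqsum N u + sqnorm (u N).
Proof. by rewrite /sqsum big_ord_recr. Qed.

Lemma sqsum_ge0 N u : 0 <= sqsum N u.
Proof. by rewrite sumr_ge0// => k _; exact: sqnorm_ge0. Qed.

Lemma le_sqsum u : {homo sqsum^~ u : M N / (M <= N)%N >-> M <= N}.
Proof.
apply: homo_leq => [//|a b c|N]; first exact: le_trans.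
by rewrite sqsumS lerDl sqnorm_ge0.
Qed.

Lemma sqbounded_ge0 u c : sqbounded u c -> 0 <= c.
Proof. by move=> /(_ 0%N); rewrite /sqsum big_ord0. Qed.

Lemma sqbounded_term u c k : sqbounded u c -> sqnorm (u k) <= c.
Proof. by move=> /(_ k.+1); apply: le_trans; rewrite sqsumS lerDr sqsum_ge0. Qed.

Lemma sqbounded_comb a u v (c d : R) : sqbounded u c -> sqbounded v d ->
  sqbounded (fun k => a * u k + v k) (2 * sqnorm a * c + 2 * d).
Proof.
move=> uc vd N.
apply: (@le_trans _ _ (2 * sqnorm a * sqsum N u + 2 * sqsum N v)).
  rewrite /sqsum !mulr_sumr -big_split/=; apply: ler_sum => k _.
  have := @sqnormD_le (a * u k) (v k) 1 ltr01.
  by rewrite sqnormM invr1; lra.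
by rewrite lerD// ler_wpM2l// mulr_ge0// sqnorm_ge0.
Qed.

Lemma l2norm_sqE u : l2norm_sq u = (\sum_(0 <= k <oo) (sqnorm (u k))%:E)%E.
Proof. by apply: eq_eseriesr => k _; rewrite normc_sqr. Qed.

Lemma l2norm_sq_ge0 u : (0 <= l2norm_sq u)%E.
Proof. by rewrite l2norm_sqE; apply: nneseries_ge0 => k _ _; rewrite lee_fin sqnorm_ge0. Qed.

Lemma sqbounded_ell2 u c : sqbounded u c -> ell2 u /\ l2norm u <= Num.sqrt c.
Proof.
move=> uc.
have H : (l2norm_sq u <= c%:E)%E.
  rewrite l2norm_sqE; apply: lime_le.
    by apply: is_cvg_nneseries => k _ _; rewrite lee_fin sqnorm_ge0.
  by apply: nearW => N; rewrite big_mkord sumEFin lee_fin; exact: uc.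
split; first by rewrite /ell2/= (le_lt_trans H)// ltry.
rewrite /l2norm ler_wsqrtr// -lee_fin fineK// ge0_fin_numE ?l2norm_sq_ge0//.
by rewrite (le_lt_trans H)// ltry.
Qed.

Lemma ell2_sqbounded u : ell2 u -> sqbounded u (l2norm u ^+ 2).
Proof.
move=> uoo N; rewrite /l2norm sqr_sqrtr ?fine_ge0 ?l2norm_sq_ge0//.
rewrite -lee_fin fineK ?ge0_fin_numE ?l2norm_sq_ge0//.
rewrite l2norm_sqE /sqsum -sumEFin -(big_mkord xpredT (fun k => (sqnorm (u k))%:E)).
by apply: nneseries_lim_ge => k _; rewrite lee_fin sqnorm_ge0.
Qed.

Lemma l2norm_ge0 u : 0 <= l2norm u. Proof. exact: sqrtr_ge0. Qed.

(* [R[i]] carries no topology in the library. *)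
Definition ccvg (s : nat -> C) z : Prop :=
  (fun n => Re (s n)) @ \oo --> Re z /\ (fun n => Im (s n)) @ \oo --> Im z.

Lemma ccvg_unique (s : nat -> C) x y : ccvg s x -> ccvg s y -> x = y.
Proof.
case: x y => [a b] [c d] [/= sa sb] [/= sc sd].
congr (_ +i* _); [exact: (cvg_unique _ sa sc)|exact: (cvg_unique _ sb sd)].
Qed.

Lemma ccvg_cst x : ccvg (fun=> x) x.
Proof. by split; exact: cvg_cst. Qed.

Lemma ccvgD (s t : nat -> C) x y : ccvg s x -> ccvg t y ->
  ccvg (fun n => s n + t n) (x + y).
Proof.
move=> [sx1 sx2] [ty1 ty2]; split.
  have -> : (fun n => Re (s n + t n)) = (fun n => Re (s n) + Re (t n)).
    by apply/funext => n; case: (s n) (t n) => [? ?] [].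
  have -> : Re (x + y) = Re x + Re y by case: x y {sx1 sx2 ty1 ty2} => [? ?] [].
  exact: cvgD.
have -> : (fun n => Im (s n + t n)) = (fun n => Im (s n) + Im (t n)).
  by apply/funext => n; case: (s n) (t n) => [? ?] [].
have -> : Im (x + y) = Im x + Im y by case: x y {sx1 sx2 ty1 ty2} => [? ?] [].
exact: cvgD.
Qed.

Lemma ccvgZ (s : nat -> C) x a : ccvg s x -> ccvg (fun n => a * s n) (a * x).
Proof.
move=> [sx1 sx2]; split.
  have -> : (fun n => Re (a * s n)) = (fun n => Re a * Re (s n) - Im a * Im (s n)).
    by apply/funext => n; case: a (s n) => [? ?] [].
  have -> : Re (a * x) = Re a * Re x - Im a * Im x.
    by case: a x {sx1 sx2} => [? ?] [].
  by apply: cvgB; apply: cvgM => //; exact: cvg_cst.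
have -> : (fun n => Im (a * s n)) = (fun n => Re a * Im (s n) + Im a * Re (s n)).
  by apply/funext => n; case: a (s n) => [? ?] [].
have -> : Im (a * x) = Re a * Im x + Im a * Re x.
  by case: a x {sx1 sx2} => [? ?] [].
by apply: cvgD; apply: cvgM => //; exact: cvg_cst.
Qed.

Lemma ccvg_sqnorm (s : nat -> C) x : ccvg s x ->
  (fun n => sqnorm (s n)) @ \oo --> sqnorm x.
Proof. by move=> [sx1 sx2]; apply: cvgD; rewrite expr2; exact: cvgM. Qed.

(** A form of Fatou's lemma: each partial sum has finitely many terms and so passes to the
    coordinatewise limit. *)
Lemma sqbounded_lim (U : nat -> nat -> C) u c :
  (forall n, sqbounded (U n) c) -> (forall k, ccvg (U^~ k) (u k)) ->
  sqbounded u c.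
Proof.
move=> Uc Uu N.
have H : (fun n => sqsum N (U n)) @ \oo --> sqsum N u.
  elim: N => [|N IH].
    have -> : (fun n => sqsum 0 (U n)) = (fun=> sqsum 0 u).
      by apply/funext => n; rewrite /sqsum !big_ord0.
    exact: cvg_cst.
  rewrite sqsumS; under eq_fun do rewrite sqsumS.
  by apply: cvgD => //; exact: ccvg_sqnorm.
rewrite -(cvg_lim _ H)//; apply: limr_le; first by apply/cvg_ex; exists (sqsum N u).
by apply: nearW => n; exact: Uc.
Qed.

(** Real and imaginary parts are dominated by a geometric series of ratio [Num.sqrt q]. *)
Lemma ccvg_series (s : nat -> C) (q c : R) : 0 <= q < 1 ->
  (forall n, sqnorm (s n) <= q ^+ n * c) ->
  exists z, ccvg (fun n => \sum_(j < n) s j) z.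
Proof.
move=> /andP[q0 q1] Hs.
have c0 : 0 <= c by have := le_trans (sqnorm_ge0 _) (Hs 0%N); rewrite mul1r.
have key (a : nat -> R) : (forall n, a n ^+ 2 <= q ^+ n * c) ->
    cvg ((fun n => \sum_(j < n) a j) @ \oo).
  move=> Ha.
  have -> : (fun n => \sum_(j < n) a j) = series a.
    by apply/funext => n; rewrite /series/= big_mkord.
  apply: normed_cvg.
  apply: (@series_le_cvg _ _ (geometric (Num.sqrt c) (Num.sqrt q))) => [n|n|n|].
  - exact: normr_ge0.
  - by rewrite /geometric/= mulr_ge0// ?exprn_ge0// sqrtr_ge0.
  - rewrite /geometric/= -(@ler_pXn2r _ 2)// ?nnegrE ?mulr_ge0 ?exprn_ge0 ?sqrtr_ge0//.
    by rewrite real_normK ?num_real// exprMn exprAC !sqr_sqrtr// mulrC.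
  - apply: is_cvg_geometric_series; rewrite ger0_norm ?sqrtr_ge0//.
    by rewrite -sqrtr1 ltr_sqrt.
have /key/cvg_ex[/= l1 H1] : forall n, Re (s n) ^+ 2 <= q ^+ n * c.
  by move=> n; apply: le_trans (Hs n); rewrite lerDl sqr_ge0.
have /key/cvg_ex[/= l2 H2] : forall n, Im (s n) ^+ 2 <= q ^+ n * c.
  by move=> n; apply: le_trans (Hs n); rewrite lerDr sqr_ge0.
exists (l1 +i* l2); split=> /=.
  have -> // : (fun n => Re (\sum_(j < n) s j)) = (fun n => \sum_(j < n) Re (s j)).
  by apply/funext => n; exact: (raddf_sum (@Re R : Rcomplex R -> R)).
have -> // : (fun n => Im (\sum_(j < n) s j)) = (fun n => \sum_(j < n) Im (s j)).
by apply/funext => n; exact: (raddf_sum (@Im R : Rcomplex R -> R)).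
Qed.

End SquareSums.

(** * Inversion of [1 - A] for a contraction [A] *)

Section Neumann.
Variable R : realType.
Local Notation C := R[i].
Local Notation Re := complex.Re.
Local Notation Im := complex.Im.
Implicit Types (u v : nat -> C).

Lemma bounded_operatorZ (S : (nat -> C) -> nat -> C) (a : C) u :
  bounded_operator S -> ell2 u -> S (fun k => a * u k) = (fun k => a * S u k).
Proof.
move=> [Sell Slin _] ul.
have zl : ell2 (fun=> 0 : C).
  have [] // : ell2 (fun=> 0 : C) /\ l2norm (fun=> 0 : C) <= Num.sqrt 0.
  by apply: sqbounded_ell2 => N; rewrite sqsum0.
have S0 : S (fun=> 0) = (fun=> 0).
  have := Slin 1 _ _ zl zl.
  under [X in S X]eq_fun do rewrite mulr0 addr0.
  move=> H; apply/funext => k; have /(congr1 (fun w => w k)) := H.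
  by rewrite mul1r -[LHS]addr0 => /addrI.
have := Slin a _ _ ul zl.
rewrite S0; under [X in S X]eq_fun do rewrite addr0.
by under [RHS]eq_fun do rewrite addr0.
Qed.

(** Since [sqbounded] bounds squares, [q] bounds the square of the operator norm. [A_cont] is
    continuity for coordinatewise convergence, which lets [A] pass through the limit defining the
    inverse. *)
Variables (A : (nat -> C) -> nat -> C) (q : R).
Hypothesis q_itv : 0 <= q < 1.
Hypothesis A_lin : forall a u v,
  A (fun k => a * u k + v k) = (fun k => a * A u k + A v k).
Hypothesis A_cont : forall (U : nat -> nat -> C) u,
  (forall k, ccvg (U^~ k) (u k)) -> forall k, ccvg (fun n => A (U n) k) (A u k).
Hypothesis A_contr : forall u c, sqbounded u c -> sqbounded (A u) (q * c).

Let T n u k : C := \sum_(j < n) iter j A u k.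

Let A0 : A (fun=> 0) = (fun=> 0).
Proof.
have := A_lin 1 (fun=> 0) (fun=> 0).
under [X in A X]eq_fun do rewrite mulr0 addr0.
move=> H; apply/funext => k; have /(congr1 (fun w => w k)) := H.
by rewrite mul1r -[LHS]addr0 => /addrI.
Qed.

Let AD u v : A (fun k => u k + v k) = (fun k => A u k + A v k).
Proof.
have := A_lin 1 u v; under [X in A X]eq_fun do rewrite mul1r.
by under [RHS]eq_fun do rewrite mul1r.
Qed.

Let iterA_lin n a u v :
  iter n A (fun k => a * u k + v k) = (fun k => a * iter n A u k + iter n A v k).
Proof. by elim: n => //= n ->; rewrite A_lin. Qed.

Let iterA_contr n u c : sqbounded u c -> sqbounded (iter n A u) (q ^+ n * c).
Proof.
move=> uc; elim: n => [|n IH]; first by rewrite mul1r.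
by rewrite exprS -mulrA; exact: A_contr.
Qed.

Let T0 u : T 0 u = (fun=> 0).
Proof. by apply/funext => k; rewrite /T big_ord0. Qed.

Let TSr n u k : T n.+1 u k = T n u k + iter n A u k.
Proof. by rewrite /T big_ord_recr. Qed.

Let TSl n u k : T n.+1 u k = u k + T n (A u) k.
Proof.
by rewrite /T big_ord_recl/=; congr (_ + _); apply: eq_bigr => j _; rewrite -iterS iterSr.
Qed.

Let TA n u : A (T n u) = T n (A u).
Proof.
elim: n => [|n IH]; first by rewrite !T0 A0.
have -> : T n.+1 u = (fun k => T n u k + iter n A u k) by apply/funext => k; exact: TSr.
by rewrite AD IH; apply/funext => k; rewrite TSr -iterS iterSr.
Qed.

(** The recursion [T n.+1 u = u + A (T n u)] and Young's inequality give the bound by induction on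
    [n]. *)
Let T_bounded : exists2 K, 0 <= K &
  forall n u c, sqbounded u c -> sqbounded (T n u) (K * c).
Proof.
case/andP: q_itv => q0 q1.
(* This weight keeps [(1 + s) * q] below 1, and [K] is then the fixed point of
   [K = (1 + s^-1) + (1 + s) * q * K]. *)
pose s := (1 - q) / 2; have s0 : 0 < s by rewrite divr_gt0// subr_gt0.
pose q' := (1 + s) * q; have q'1 : 0 < 1 - q' by rewrite /q' /s; nra.
pose K := (1 + s^-1) / (1 - q').
have s1 : 0 <= 1 + s^-1 by rewrite addr_ge0// invr_ge0 ltW.
have K0 : 0 <= K by rewrite divr_ge0// ltW.
exists K => // n u c uc; have c0 := sqbounded_ge0 uc.
elim: n => [|n IH] N; first by rewrite T0 sqsum0 mulr_ge0.
apply: (@le_trans _ _ ((1 + s^-1) * sqsum N u + (1 + s) * sqsum N (A (T n u)))).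
  rewrite /sqsum !mulr_sumr -big_split/=; apply: ler_sum => k _.
  by rewrite TSl -TA; exact: sqnormD_le.
have -> : K * c = (1 + s^-1) * c + (1 + s) * (q * (K * c)).
  rewrite /K -/q'; have -> : (1 + s) * (q * ((1 + s^-1) / (1 - q') * c)) =
    q' * ((1 + s^-1) / (1 - q') * c) by rewrite /q'; ring.
  by field; rewrite !lt0r_neq0.
apply: lerD; rewrite ler_wpM2l//; first by rewrite addr_ge0// ltW.
exact: A_contr IH N.
Qed.

(** The sum of the Neumann series, coordinate by coordinate; [S_cvg] shows that on [ell2] these
    limits are genuine. *)
Let S u k : C := lim ((fun n => Re (T n u k)) @ \oo) +i* lim ((fun n => Im (T n u k)) @ \oo).

Let S_cvg u : ell2 u -> forall k, ccvg (fun n => T n u k) (S u k).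
Proof.
move=> /ell2_sqbounded uc k.
have [n|z [z1 z2]] := @ccvg_series _ (fun j => iter j A u k) q (l2norm u ^+ 2) q_itv.
  by apply: sqbounded_term; exact: iterA_contr uc.
by split=> /=; apply/cvg_ex; [exists (Re z)|exists (Im z)].
Qed.

Lemma neumann : exists S' : (nat -> C) -> nat -> C, bounded_operator S' /\
  forall u, ell2 u -> S' (fun k => u k - A u k) = u /\
                      (fun k => S' u k - A (S' u) k) = u.
Proof.
have [K K0 TK] := T_bounded.
have Sb u : ell2 u -> sqbounded (S u) (K * l2norm u ^+ 2).
  move=> ul; apply: sqbounded_lim (S_cvg ul) => n.
  exact/TK/ell2_sqbounded.
have Sell u : ell2 u -> ell2 (S u) by move=> /Sb/sqbounded_ell2[].
have comb_ell2 a u v : ell2 u -> ell2 v -> ell2 (fun k => a * u k + v k).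
  move=> /ell2_sqbounded uc /ell2_sqbounded vc.
  by have [] := sqbounded_ell2 (sqbounded_comb a uc vc).
have Slin a u v : ell2 u -> ell2 v ->
    S (fun k => a * u k + v k) = (fun k => a * S u k + S v k).
  move=> ul vl; apply/funext => k.
  apply: ccvg_unique (S_cvg (comb_ell2 a _ _ ul vl) k) _.
  have -> : (fun n => T n (fun j => a * u j + v j) k) =
            (fun n => a * T n u k + T n v k).
    apply/funext => n; rewrite /T mulr_sumr -big_split/=.
    by apply: eq_bigr => j _; rewrite iterA_lin.
  by apply: ccvgD; [apply: ccvgZ|]; exact: S_cvg.
have Aell u : ell2 u -> ell2 (A u).
  by move=> /ell2_sqbounded/A_contr/sqbounded_ell2[].
have ccvgS (s : nat -> C) z : ccvg s z -> ccvg (fun n => s n.+1) z.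
  by move=> [s1 s2]; split; [move: s1|move: s2];
    rewrite -(cvg_shiftS (fun n => _ (s n))).
(* The limit of [TSl] gives [S = 1 + S A]. Together with [A S = S A], the limit of [TA], this makes
   [S] a two-sided inverse. *)
have SE u : ell2 u -> S u = (fun k => u k + S (A u) k).
  move=> ul; apply/funext => k.
  apply: ccvg_unique (ccvgS _ _ (S_cvg ul k)) _.
  under eq_fun do rewrite TSl.
  by apply: ccvgD; [exact: ccvg_cst|exact/S_cvg/Aell].
have SA u : ell2 u -> A (S u) = S (A u).
  move=> ul; apply/funext => k.
  apply: ccvg_unique (A_cont (S_cvg ul) k) _.
  under eq_fun do rewrite TA.
  exact/S_cvg/Aell.
exists S; split.
  split=> //; exists (Num.sqrt K) => u ul.
  have [_] := sqbounded_ell2 (Sb u ul).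
  by rewrite sqrtrM// sqrtr_sqr ger0_norm ?l2norm_ge0.
move=> u ul; split.
  have := Slin (- 1) _ _ (Aell _ ul) ul.
  have -> : (fun k => - 1 * A u k + u k) = (fun k => u k - A u k).
    by apply/funext => k; rewrite mulN1r addrC.
  by move=> ->; apply/funext => k; rewrite [in S u](SE _ ul); ring.
apply/funext => k; rewrite SA// [in S u](SE _ ul); ring.
Qed.

End Neumann.

(** * The spectrum of a Schrodinger operator *)

Section Schrodinger.
Variable R : realType.
Local Notation C := R[i].
Local Notation Re := complex.Re.
Local Notation Im := complex.Im.
Implicit Types (u v : nat -> C) (V : nat -> R).

(** * Upper bound: energies outside the interval lie in the resolvent set *)

Lemma sq3_le (a b c v r : R) : `|v| <= r ->
  (a + b + v * c) ^+ 2 <= (2 + r) * (a ^+ 2 + b ^+ 2 + r * c ^+ 2).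
Proof.
move=> vr; have v0 := normr_ge0 v.
(* Cauchy-Schwarz with weights 1, 1 and [|v|]; the defect is written as an explicit sum of squares
   for each sign of [v]. *)
apply: (@le_trans _ _ ((2 + `|v|) * (a ^+ 2 + b ^+ 2 + `|v| * c ^+ 2))).
  rewrite -subr_ge0; have [v1|v1] := ger0P v.
    have -> : (2 + v) * (a ^+ 2 + b ^+ 2 + v * c ^+ 2) - (a + b + v * c) ^+ 2 =
      (a - b) ^+ 2 + v * ((a - c) ^+ 2 + (b - c) ^+ 2) by ring.
    by rewrite addr_ge0 ?sqr_ge0// mulr_ge0// addr_ge0// sqr_ge0.
  have -> : (2 + - v) * (a ^+ 2 + b ^+ 2 + - v * c ^+ 2) - (a + b + v * c) ^+ 2 =
    (a - b) ^+ 2 + - v * ((a + c) ^+ 2 + (b + c) ^+ 2) by ring.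
  by rewrite addr_ge0 ?sqr_ge0// mulr_ge0 ?oppr_ge0 ?(ltW v1)// addr_ge0// sqr_ge0.
apply: ler_pM; first by rewrite addr_ge0.
- by rewrite !addr_ge0 ?sqr_ge0// mulr_ge0// sqr_ge0.
- by rewrite lerD2l.
- by rewrite lerD2l ler_wpM2r// sqr_ge0.
Qed.

(** The imaginary part of [u k] times the conjugate of [u k.+1]: the boundary term in Green's
    formula. The cross term between [(H - c) u] and [i t u] at a site is a difference of consecutive
    values, which expresses the symmetry of [H]. *)
Definition wronskian u k : R := Re (u k.+1) * Im (u k) - Im (u k.+1) * Re (u k).

Lemma sqnorm_schrodinger0 V u (c t r : R) : `|V 0%N - c| <= r ->
  sqnorm (schrodinger V u 0 - (c +i* t) * u 0%N) <=
  (2 + r) * (sqnorm (u 1%N) + r * sqnorm (u 0%N)) + t ^+ 2 * sqnorm (u 0%N)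
  + 2 * t * wronskian u 0.
Proof.
rewrite /schrodinger /wronskian /sqnorm.
case: (u 0%N) (u 1%N) => [a b] [a1 b1] vr /=.
have h1 := sq3_le a1 0 a vr; have h2 := sq3_le b1 0 b vr.
rewrite expr0n/= addr0 in h1; rewrite expr0n/= addr0 in h2.
rewrite -subr_ge0 in h1; rewrite -subr_ge0 in h2; rewrite -subr_ge0.
apply: le_trans (addr_ge0 h1 h2) _; rewrite le_eqVlt; apply/orP; left.
by apply/eqP; ring.
Qed.

Lemma sqnorm_schrodingerS V u (c t r : R) k : `|V k.+1 - c| <= r ->
  sqnorm (schrodinger V u k.+1 - (c +i* t) * u k.+1) <=
  (2 + r) * (sqnorm (u k.+2) + sqnorm (u k) + r * sqnorm (u k.+1))
  + t ^+ 2 * sqnorm (u k.+1) + 2 * t * (wronskian u k.+1 - wronskian u k).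
Proof.
rewrite /schrodinger /wronskian /sqnorm.
case: (u k) (u k.+1) (u k.+2) => [a0 b0] [a b] [a1 b1] vr /=.
have h1 := sq3_le a1 a0 a vr; have h2 := sq3_le b1 b0 b vr.
rewrite -subr_ge0 in h1; rewrite -subr_ge0 in h2; rewrite -subr_ge0.
apply: le_trans (addr_ge0 h1 h2) _; rewrite le_eqVlt; apply/orP; left.
by apply/eqP; ring.
Qed.

(** In the sum over sites the Wronskians telescope to the one at the cutoff. Each [sqnorm (u k)] is
    collected at most from its two neighbours and, with weight [r], from its own site, which yields
    the second factor [2 + r]. *)
Lemma sqsum_schrodinger V u (c t r : R) N : (forall k, `|V k - c| <= r) ->
  sqsum N.+1 (fun k => schrodinger V u k - (c +i* t) * u k) <=
  ((2 + r) ^+ 2 + t ^+ 2) * sqsum N.+2 u + 2 * t * wronskian u N.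
Proof.
move=> Vr; have r0 : 0 <= r := le_trans (normr_ge0 _) (Vr 0%N).
apply: (@le_trans _ _ ((2 + r) * (sqsum N.+2 u + sqsum N u + r * sqsum N.+1 u)
  + t ^+ 2 * sqsum N.+1 u + 2 * t * wronskian u N)).
  elim: N => [|N IH].
    have := sqnorm_schrodinger0 u t (Vr 0%N).
    have := sqnorm_ge0 (u 0%N).
    rewrite !sqsumS /sqsum !big_ord0 !add0r addr0 => h.
    move/le_trans; apply; rewrite lerD2r lerD2r ler_wpM2l ?addr_ge0//.
    by rewrite lerD2r lerDr.
  rewrite sqsumS; apply: (le_trans (lerD IH (sqnorm_schrodingerS _ _ (Vr _)))).
  by rewrite !sqsumS le_eqVlt; apply/orP; left; apply/eqP; ring.
rewrite lerD2r -subr_ge0.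
have -> : ((2 + r) ^+ 2 + t ^+ 2) * sqsum N.+2 u -
  ((2 + r) * (sqsum N.+2 u + sqsum N u + r * sqsum N.+1 u) + t ^+ 2 * sqsum N.+1 u) =
  (2 + r) * (sqsum N.+2 u - sqsum N u) + ((2 + r) * r + t ^+ 2) * (sqsum N.+2 u - sqsum N.+1 u).
  by ring.
apply: addr_ge0; apply: mulr_ge0; rewrite ?subr_ge0.
- exact: addr_ge0.
- by apply: le_sqsum; rewrite leqW.
- by apply: addr_ge0; [apply: mulr_ge0 => //; exact: addr_ge0|exact: sqr_ge0].
- exact: le_sqsum.
Qed.

Lemma wronskian_le u k (t : R) :
  2 * t * wronskian u k <= `|t| * (sqnorm (u k) + sqnorm (u k.+1)).
Proof.
rewrite /wronskian /sqnorm; case: (u k) (u k.+1) => [a b] [c d] /=.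
rewrite -subr_ge0; have [t0|t0] := ger0P t.
  have -> : t * (a ^+ 2 + b ^+ 2 + (c ^+ 2 + d ^+ 2)) - 2 * t * (c * b - d * a) =
    t * ((c - b) ^+ 2 + (d + a) ^+ 2) by ring.
  by rewrite mulr_ge0// addr_ge0// sqr_ge0.
have -> : - t * (a ^+ 2 + b ^+ 2 + (c ^+ 2 + d ^+ 2)) - 2 * t * (c * b - d * a) =
  - t * ((c + b) ^+ 2 + (d - a) ^+ 2) by ring.
by rewrite mulr_ge0 ?oppr_ge0 ?(ltW t0)// addr_ge0// sqr_ge0.
Qed.

Lemma sqbounded_cvg0 u c : sqbounded u c -> (fun k => sqnorm (u k)) @ \oo --> 0.
Proof.
move=> uc; apply: cvg_series_cvg_0.
have -> : series (fun k => sqnorm (u k)) = (fun n => sqsum n u).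
  by apply/funext => n; rewrite /series/= big_mkord.
apply: nondecreasing_is_cvgn; first exact: le_sqsum.
by exists c => _ [n _ <-]; exact: uc.
Qed.

Lemma sqbounded_schrodinger V u (c t r b : R) : (forall k, `|V k - c| <= r) ->
  sqbounded u b ->
  sqbounded (fun k => schrodinger V u k - (c +i* t) * u k)
            (((2 + r) ^+ 2 + t ^+ 2) * b).
Proof.
move=> Vr ub N; apply/ler_addgt0Pr => e e0.
have u0 := sqbounded_cvg0 ub.
have u1 : (fun k => `|t| * (sqnorm (u k) + sqnorm (u k.+1))) @ \oo --> 0.
  rewrite -(mulr0 `|t|); apply: cvgM; first exact: cvg_cst.
  rewrite -(addr0 0); apply: cvgD => //.
  by rewrite (cvg_shiftS (fun k => sqnorm (u k))).
(* Partial sums increase, so the cutoff may be moved out to [N + M], where the boundary term is at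
   most [e]. *)
have /cvgr0Pnorm_le/(_ _ e0)[M _ /(_ (N + M)%N)] := u1.
rewrite /= leq_addl => /(_ isT) /(le_trans (ler_norm _)) H.
apply: (@le_trans _ _ (sqsum (N + M).+1 (fun k => schrodinger V u k - (c +i* t) * u k))).
  by apply: le_sqsum; rewrite leqW// leq_addr.
apply: (le_trans (sqsum_schrodinger _ _ _ Vr)).
apply: lerD; last by apply: le_trans H; exact: wronskian_le.
by rewrite ler_wpM2l// ?addr_ge0 ?sqr_ge0.
Qed.

Lemma schrodinger_lin V (a : C) u v :
  schrodinger V (fun k => a * u k + v k) =
  (fun k => a * schrodinger V u k + schrodinger V v k).
Proof. by apply/funext => -[|k] /=; ring. Qed.

Lemma schrodingerZ V (a : C) u k :
  schrodinger V (fun k => a * u k) k = a * schrodinger V u k.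
Proof. by case: k => [|k] /=; ring. Qed.

Lemma schrodinger_cont V (U : nat -> nat -> C) u :
  (forall k, ccvg (U^~ k) (u k)) ->
  forall k, ccvg (fun n => schrodinger V (U n) k) (schrodinger V u k).
Proof.
by move=> Uu [|k] /=; do ?apply: ccvgD => //; apply: ccvgZ.
Qed.

Lemma resolvent_schrodinger V (c t r : R) (z : C) : (forall k, `|V k - c| <= r) ->
  (2 + r) ^+ 2 + t ^+ 2 < sqnorm (z - (c +i* t)) ->
  resolvent_set (schrodinger V) z.
Proof.
set w := c +i* t; set kappa := (2 + r) ^+ 2 + t ^+ 2 => Vr kz.
have k0 : 0 <= kappa by rewrite addr_ge0// sqr_ge0.
have n0 := le_lt_trans k0 kz.
have zw0 : z - w != 0 by rewrite -sqnorm_eq0 gt_eqF.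
(* With this [A], [H - z = - (z - w) (1 - A)], and the squared norm of [A] is at most
   [kappa / sqnorm (z - w) < 1]. *)
pose A u k := (z - w)^-1 * (schrodinger V u k - w * u k).
have q_itv : 0 <= kappa / sqnorm (z - w) < 1.
  by rewrite divr_ge0 ?sqnorm_ge0//= ltr_pdivrMr// mul1r.
have Ab u b : sqbounded u b -> sqbounded (A u) (kappa / sqnorm (z - w) * b).
  move=> ub N; have := sqbounded_schrodinger t Vr ub N.
  rewrite -/w -/kappa => H.
  have -> : sqsum N (A u) = (sqnorm (z - w))^-1 * sqsum N (fun k => schrodinger V u k - w * u k).
    rewrite /sqsum mulr_sumr; apply: eq_bigr => k _.
    by rewrite sqnormM sqnormV.
  by rewrite (mulrC kappa) -mulrA ler_wpM2l// invr_ge0 sqnorm_ge0.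
have [a u v|U u Uu k|S [Sb HS]] := neumann q_itv _ _ Ab.
- by apply/funext => k; rewrite /A schrodinger_lin; ring.
- apply: ccvgZ; under eq_fun do rewrite -mulNr.
  by rewrite -mulNr; apply: ccvgD; [exact: schrodinger_cont|exact: ccvgZ].
have HA u k : schrodinger V u k - z * u k = - (z - w) * (u k - A u k).
  by rewrite /A mulrBr mulNr mulNr mulVKf//; ring.
exists (fun u k => - (z - w)^-1 * S u k).
have [Sell Slin [c' Sc']] := Sb.
have scale_l2 a u : ell2 u -> ell2 (fun k => a * u k) /\
    l2norm (fun k => a * u k) <= Num.sqrt (sqnorm a) * l2norm u.
  move=> /ell2_sqbounded ub.
  have [|H1 H2] := @sqbounded_ell2 _ (fun k => a * u k) (sqnorm a * l2norm u ^+ 2).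
    move=> N; apply: le_trans (ler_wpM2l (sqnorm_ge0 a) (ub N)).
    by rewrite /sqsum mulr_sumr; apply: ler_sum => k _; rewrite sqnormM.
  split=> //; apply: le_trans H2 _.
  by rewrite sqrtrM ?sqnorm_ge0// sqrtr_sqr ger0_norm ?l2norm_ge0.
split.
- split=> [u /Sell ul|a u v ul vl|].
  + exact: (scale_l2 _ _ ul).1.
  + by rewrite Slin//; apply/funext => k; ring.
  + exists (Num.sqrt (sqnorm (- (z - w)^-1)) * c') => u ul.
    apply: le_trans (scale_l2 _ _ (Sell _ ul)).2 _.
    by rewrite -mulrA ler_wpM2l ?sqrtr_ge0// Sc'.
- move=> u ul; apply/funext => k.
  have -> : (fun k => schrodinger V u k - z * u k) =
            (fun k => - (z - w) * (u k - A u k)) by apply/funext.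
  rewrite (bounded_operatorZ _ Sb); last first.
    have [|//] := @sqbounded_ell2 _ (fun k => u k - A u k)
      (2 * sqnorm (- 1) * (kappa / sqnorm (z - w) * l2norm u ^+ 2) + 2 * l2norm u ^+ 2).
    have -> : (fun k => u k - A u k) = (fun k => - 1 * A u k + u k).
      by apply/funext => k'; rewrite mulN1r addrC.
    by apply: sqbounded_comb; [apply: Ab|]; exact: ell2_sqbounded.
  by rewrite (HS u ul).1 mulrA mulrNN mulVf// mul1r.
- move=> u ul; apply/funext => k.
  have [_ /(congr1 (fun v => v k)) <-] := HS u ul.
  by rewrite HA /A schrodingerZ; field.
Qed.

Lemma spectrum_schrodinger_sub V (m M : R) : (forall k, m <= V k <= M) ->
  spectrum (schrodinger V) `<=` [set x%:C | x in `[m - 2, M + 2]].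
Proof.
move=> VmM [x y]; apply: contra_notP => /= xynot.
pose c := (m + M) / 2; pose r := (M - m) / 2.
have Vr k : `|V k - c| <= r.
  by have /andP[] := VmM k; rewrite ler_norml /c /r; lra.
have r0 : 0 <= r := le_trans (normr_ge0 _) (Vr 0%N).
(* The interval has centre [c] and half-length [2 + r], so for real [z] outside it [t = 0]
   suffices. *)
have [y0|y0] := eqVneq y 0.
  apply: (@resolvent_schrodinger V c 0 r _ Vr).
  rewrite /sqnorm/= y0 subr0 expr0n/= !addr0 -[ltRHS]real_normK ?num_real//.
  rewrite ltr_pXn2r// ?nnegrE ?addr_ge0// ltNge; apply/negP => H.
  apply: xynot; exists x; last by rewrite y0.
  rewrite in_itv/=.
  by move: H; rewrite ler_norml /c /r; lra.
(* [t] solves [y ^ 2 - 2 y t = (2 + r) ^ 2 + 1]. *)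
pose t := (y ^+ 2 - (2 + r) ^+ 2 - 1) / (2 * y).
apply: (@resolvent_schrodinger V c t r _ Vr).
rewrite /sqnorm/=.
have -> : (y - t) ^+ 2 = (2 + r) ^+ 2 + 1 + t ^+ 2 by rewrite /t; field.
by have := sqr_ge0 (x - c); lra.
Qed.

(** * Lower bound: cut-off plane waves as approximate eigenvectors *)

Lemma sum_pred1_le1 N a : \sum_(k < N) ((k : nat) == a)%:R <= 1 :> R.
Proof.
suff -> : \sum_(k < N) ((k : nat) == a)%:R = (a < N)%:R :> R.
  by case: (a < N)%N.
elim: N => [|N IH]; first by rewrite big_ord0.
rewrite big_ord_recr/= IH -natrD; congr _%:R.
by lia.
Qed.

Lemma sum_interval N n m : \sum_(k < N) (n < k <= n + m)%N%:R =
  (minn N (n + m).+1 - minn N n.+1)%N%:R :> R.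
Proof.
elim: N => [|N IH]; first by rewrite big_ord0 !min0n.
rewrite big_ord_recr/= IH -natrD; congr _%:R.
by lia.
Qed.

(** The value 0 before the first site encodes the boundary condition and merges the two cases of
    [schrodinger]. *)
Definition prev u k : C := if k is j.+1 then u j else 0.

Section PlaneWave.
Variables (s : R) (n L : nat).
Hypothesis s2 : `|s| <= 2.

(** The root of [z ^ 2 - s z + 1] on the unit circle: its powers solve the free equation at energy
    [s = 2 cos phi]. *)
Let zeta : C := (s / 2) +i* Num.sqrt (1 - (s / 2) ^+ 2).

Definition plane_wave k : C := if (n < k <= n + L.+1)%N then zeta ^+ (k - n) else 0.

Let zeta2 : zeta ^+ 2 = s%:C * zeta - 1.
Proof.
have h : Num.sqrt (1 - (s / 2) ^+ 2) ^+ 2 = 1 - (s / 2) ^+ 2.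
  rewrite sqr_sqrtr//; move: s2; rewrite ler_norml => /andP[s2a s2b].
  by nra.
rewrite /zeta; move: h; set r := Num.sqrt _ => h.
apply/eqP; rewrite expr2 eq_complex/=; apply/andP; split; apply/eqP.
  by rewrite -(expr2 r) h; field.
by field.
Qed.

Let sqnorm_zeta : sqnorm zeta = 1.
Proof.
rewrite /sqnorm/= sqr_sqrtr; first by ring.
move: s2; rewrite ler_norml => /andP[s2a s2b].
by nra.
Qed.

Lemma sqnorm_plane_wave k : sqnorm (plane_wave k) = (n < k <= n + L.+1)%N%:R.
Proof.
by rewrite /plane_wave; case: ifP => _; rewrite ?sqnorm0// sqnormX sqnorm_zeta expr1n.
Qed.

(** The free equation holds exactly inside the block and trivially away from it, so only the two
    sites at each end contribute. *)
Lemma plane_wave_defect k :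
  sqnorm (plane_wave k.+1 + prev plane_wave k - s%:C * plane_wave k) <=
  16 * ((k == n)%:R + (k == n.+1)%:R + (k == n + L.+1)%:R + (k == (n + L).+2)%:R).
Proof.
have w1 j : sqnorm (plane_wave j) <= 1 by rewrite sqnorm_plane_wave lern1 leq_b1.
have p1 : sqnorm (prev plane_wave k) <= 1 by case: k => [|k]; rewrite /= ?sqnorm0.
(* Young's inequality twice with weight 1: [2 * (2 + 2) + 2 * 4]. *)
have e16 : sqnorm (plane_wave k.+1 + prev plane_wave k - s%:C * plane_wave k) <= 16.
  have h1 := sqnormD_le (plane_wave k.+1 + prev plane_wave k) (- s%:C * plane_wave k) ltr01.
  have h2 := sqnormD_le (plane_wave k.+1) (prev plane_wave k) ltr01.
  have h3 : sqnorm (- s%:C * plane_wave k) <= 4.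
    rewrite sqnormM -rmorphN/= sqnorm_real sqrrN.
    rewrite -[leRHS]mulr1 ler_pM ?sqr_ge0 ?sqnorm_ge0//.
    by move: s2; rewrite ler_norml => /andP[s2a s2b]; nra.
  rewrite -mulNr; move: h1 h2 (w1 k.+1); rewrite invr1; lra.
have [E|E] := boolP [|| k == n, k == n.+1, k == (n + L.+1)%N | k == (n + L).+2].
  apply: le_trans e16 _; rewrite ler_peMr// -!natrD ler1n.
  by move: E; do 4!case: (_ == _).
have [/= E1 E2 E3 E4] : [/\ k != n, k != n.+1, k != (n + L.+1)%N & k != (n + L).+2].
  by move: E; rewrite !negb_or => /and4P.
rewrite (negbTE E1) (negbTE E2) (negbTE E3) (negbTE E4) !addr0 mulr0.
suff -> : plane_wave k.+1 + prev plane_wave k - s%:C * plane_wave k = 0 by rewrite sqnorm0.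
have [/andP[k1 k2]|kout] := boolP (n.+1 < k < n + L.+1)%N.
  case: k {p1 e16 E E1 E2 E3 E4} k1 k2 => // k k1 k2.
  rewrite /prev /plane_wave !ifT; try lia.
  have -> : (k.+2 - n = 2 + (k - n))%N by lia.
  have -> : (k.+1 - n = (k - n).+1)%N by lia.
  by rewrite exprD zeta2 exprS; ring.
rewrite /plane_wave; case: k E1 E2 E3 E4 kout {p1 e16 E} => [|k] E1 E2 E3 E4 kout.
  by rewrite /= ifF; [ring|lia].
by rewrite /= !ifF; [ring|lia|lia|lia].
Qed.

(** The oscillation of [V] costs [e ^ 2] per site of the block, while the ends cost
    [128 = 2 * 16 * 4] whatever its length; the 2 comes from Young's inequality. *)
Lemma plane_wave_approx V (y e : R) : 0 <= e ->
  (forall j, (j <= L.+1)%N -> `|V (n + j)%N - y| <= e) ->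
  sqbounded (fun k => schrodinger V plane_wave k - (y + s)%:C * plane_wave k)
    (2 * e ^+ 2 * L.+1%:R + 128).
Proof.
move=> e0 Ve N.
have H k : sqnorm (schrodinger V plane_wave k - (y + s)%:C * plane_wave k) <=
  2 * e ^+ 2 * (n < k <= n + L.+1)%N%:R +
  32 * ((k == n)%:R + (k == n.+1)%:R + (k == n + L.+1)%:R + (k == (n + L).+2)%:R).
  have -> : schrodinger V plane_wave k - (y + s)%:C * plane_wave k =
    (V k - y)%:C * plane_wave k + (plane_wave k.+1 + prev plane_wave k - s%:C * plane_wave k).
    by rewrite rmorphB rmorphD/= /prev; case: (k) => [|j] /=; ring.
  have := plane_wave_defect k => h1.
  have := sqnormD_le ((V k - y)%:C * plane_wave k)
    (plane_wave k.+1 + prev plane_wave k - s%:C * plane_wave k) ltr01.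
  have : sqnorm ((V k - y)%:C * plane_wave k) <= e ^+ 2 * (n < k <= n + L.+1)%N%:R.
    rewrite sqnormM sqnorm_real sqnorm_plane_wave.
    have [/andP[k1 k2]|_] := boolP (n < k <= n + L.+1)%N; last by rewrite !mulr0.
    rewrite !mulr1 -[leLHS]real_normK ?num_real// ler_pXn2r ?nnegrE//.
    by rewrite -(subnKC (ltnW k1)); apply: Ve; lia.
  by move: h1; rewrite invr1; lra.
apply: (@le_trans _ _ (2 * e ^+ 2 * \sum_(k < N) (n < k <= n + L.+1)%N%:R +
  32 * (\sum_(k < N) ((k : nat) == n)%:R + \sum_(k < N) ((k : nat) == n.+1)%:R +
    \sum_(k < N) ((k : nat) == n + L.+1)%:R + \sum_(k < N) ((k : nat) == (n + L).+2)%:R))).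
  rewrite /sqsum -!big_split/= !mulr_sumr -big_split/=.
  by apply: ler_sum => k _; exact: H.
apply: lerD.
  rewrite ler_wpM2l ?mulr_ge0 ?sqr_ge0// sum_interval ler_nat.
  by lia.
have := sum_pred1_le1 N n; have := sum_pred1_le1 N n.+1.
have := sum_pred1_le1 N (n + L.+1); have := sum_pred1_le1 N (n + L).+2.
by lra.
Qed.

Lemma l2norm_plane_wave : ell2 plane_wave /\ L.+1%:R <= l2norm plane_wave ^+ 2.
Proof.
have E N : sqsum N plane_wave = (minn N (n + L.+1).+1 - minn N n.+1)%N%:R.
  rewrite -sum_interval; apply: eq_bigr => k _; exact: sqnorm_plane_wave.
have [|wl _] := @sqbounded_ell2 _ plane_wave L.+1%:R.
  by move=> N; rewrite E ler_nat; lia.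
split=> //; have := ell2_sqbounded wl (n + L.+1).+1.
rewrite E; congr (_%:R <= _); lia.
Qed.

End PlaneWave.

(** An inverse with bound [c] would force [L.+1 <= c ^ 2 * (2 * e ^ 2 * L.+1 + 128)], which fails
    for small [e] and large [L]. *)
Lemma spectrum_schrodinger_sup V (y s : R) : `|s| <= 2 ->
  (forall e L, 0 < e -> exists n, forall j, (j <= L)%N -> `|V (n + j)%N - y| <= e) ->
  spectrum (schrodinger V) (y + s)%:C.
Proof.
move=> s2 Vy [S [[Sell Slin [c Sc]] SE _]].
(* This makes the part of the error proportional to [L.+1] at most half of [L.+1]; the added 1
   covers [c = 0]. *)
pose e := (2 * (`|c| + 1))^-1.
have c0 := normr_ge0 c.
have e0 : 0 < e by rewrite invr_gt0; lra.
have ce : c ^+ 2 * (2 * e ^+ 2) <= 1 / 2.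
  rewrite -(real_normK (num_real c)).
  have ce1 : `|c| * e <= 1 / 2 by rewrite ler_pdivrMr; lra.
  have ce0 : 0 <= `|c| * e by rewrite mulr_ge0// ltW.
  have -> : `|c| ^+ 2 * (2 * e ^+ 2) = 2 * (`|c| * e) ^+ 2 by ring.
  by nra.
(* This makes the end contribution [128 * c ^ 2] less than the other half. *)
pose L := Num.truncn (256 * c ^+ 2).
have Lc : 256 * c ^+ 2 < L.+1%:R by exact: truncnS_gt.
have [n Hn] := Vy e L.+1 e0.
have [wl wL] := l2norm_plane_wave n L s2.
have wb := plane_wave_approx s2 (ltW e0) Hn.
have [dl dn] := sqbounded_ell2 wb.
have := Sc _ dl; rewrite SE//.
set d := l2norm (fun k => _) in dn *.
have d2 : d ^+ 2 <= 2 * e ^+ 2 * L.+1%:R + 128.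
  rewrite -[leRHS]sqr_sqrtr; last exact: sqbounded_ge0 wb.
  by rewrite ler_pXn2r ?nnegrE ?l2norm_ge0 ?sqrtr_ge0.
move=> wcd.
have : l2norm (plane_wave s n L) ^+ 2 <= c ^+ 2 * d ^+ 2.
  rewrite -exprMn ler_pXn2r ?nnegrE ?l2norm_ge0//.
  exact: le_trans (l2norm_ge0 _) wcd.
have L0 : (0 : R) < L.+1%:R by [].
have := ler_wpM2l (sqr_ge0 c) d2.
have := ler_wpM2r (ltW L0) ce.
by rewrite !mulrDr !mulrA; lra.
Qed.

End Schrodinger.

(** * Continuous functions on the circle *)

Section CircleFunctions.
Variable R : realType.

Lemma to_circleDz (t : R) (p : int) : to_circle (t + p%:~R) = to_circle t.
Proof.
apply/eqmodP; rewrite /= /eqmod1 addrAC subrr add0r.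
exact: intr_int.
Qed.

Lemma to_circle_surj (c : circle R) : exists2 t : R, 0 <= t <= 1 & to_circle t = c.
Proof.
pose t := repr (c : {eq_quot (@eqmod1_rel R)}%qT).
have /andP[t1 t2] := Num.Theory.floor_itv t.
exists (t + (- Num.floor t)%:~R).
  by rewrite rmorphN/=; move: t2; rewrite intrD; lra.
by rewrite to_circleDz /to_circle reprK.
Qed.

Variable f : circle R -> R.
Hypothesis f_cont : continuous f.

Lemma continuous_lift : continuous (f \o @to_circle R).
Proof.
move=> t; apply: continuous_comp; last exact: f_cont.
exact: pi_continuous.
Qed.

(** Compactness comes from [[0, 1]], which covers the circle. *)
Lemma circle_EVT : exists m M : R, is_min f m /\ is_max f M.
Proof.
have gc : {within `[0 : R, 1], continuous (f \o @to_circle R)}.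
  exact: continuous_subspaceT continuous_lift.
have [a _ ha] := EVT_min ler01 gc; have [b _ hb] := EVT_max ler01 gc.
exists (f (to_circle a)), (f (to_circle b)); split; split.
- by exists (to_circle a).
- by move=> _ [c _ <-]; have [t t01 <-] := to_circle_surj c; apply: ha; rewrite in_itv.
- by exists (to_circle b).
- by move=> _ [c _ <-]; have [t t01 <-] := to_circle_surj c; apply: hb; rewrite in_itv.
Qed.

Lemma circle_IVT (m M y : R) : is_min f m -> is_max f M -> m <= y <= M ->
  exists t : R, f (to_circle t) = y.
Proof.
move=> [[c1 _ f1] _] [[c2 _ f2] _] yy.
have [a _ ha] := to_circle_surj c1; have [b _ hb] := to_circle_surj c2.
have mM : m <= M by case/andP: yy => /le_trans/[apply].
have within_lift (u v : R) : {within `[u, v], continuous (f \o @to_circle R)}.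
  exact: continuous_subspaceT continuous_lift.
have [ab|/ltW ba] := leP a b.
  have [|t _ ht] := IVT ab (within_lift _ _) (v := y); last by exists t.
  by rewrite /= ha hb f1 f2 min_l// max_r.
have [|t _ ht] := IVT ba (within_lift _ _) (v := y); last by exists t.
by rewrite /= ha hb f1 f2 min_r// max_l.
Qed.

Lemma block_dense_circle (g : nat -> R) (theta t e : R) (L : nat) :
  block_dense g -> 0 < e -> exists n, forall j, (j <= L)%N ->
  `|f (to_circle (g (n + j)%N + theta)) - f (to_circle t)| <= e.
Proof.
move=> gd e0.
have /cvgrPdist_le/(_ _ e0)/nbhs_ballP[d /= d0 Hd] := @continuous_lift t.
(* The target absorbs the phase [theta]; halving [d] gives the strict inequality that the ball
   requires. *)
have [|n Hn] := gd (t - theta) (d / 2) L; first by rewrite divr_gt0.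
exists n => j /Hn[p Hp].
rewrite -(to_circleDz _ (- p)) distrC; apply: Hd; rewrite /ball/= distrC.
rewrite rmorphN/=; apply: (@le_lt_trans _ _ (d / 2)); last by lra.
by congr (`|_| <= _) : Hp; ring.
Qed.

End CircleFunctions.

(** * The spectrum for the potential sampled along [alpha * n ^ rho + theta] *)

Theorem theorem1p1 (R : realType) (f : circle R -> R) (hf : continuous f)
    (alpha : R) (halpha : alpha != 0) (theta : R)
    (rho : R) (hrho : 0 < rho) (hrho_int : rho \isn't a Num.int) :
  exists m M : R, [/\ is_min f m, is_max f M &
    spectrum (schrodinger
      (fun k => f (to_circle (alpha * k.+1%:R `^ rho + theta)))) =
    [set x%:C | x in `[m - 2, M + 2]]].
Proof.
have [m [M [fm fM]]] := circle_EVT hf; exists m, M; split=> //.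
apply/seteqP; split.
  apply: spectrum_schrodinger_sub => k.
  by apply/andP; split; [apply: fm.2|apply: fM.2];
    exists (to_circle (alpha * k.+1%:R `^ rho + theta)).
move=> _ [x + <-]; rewrite /= in_itv/= => /andP[x1 x2].
have mM : m <= M by case: fm fM => -[c _ <-] _ [_]; apply; exists c.
(* Clamping [x] to [[m, M]] splits the energy into a value [y] of [f] and a free energy [x - y] in
   [[-2, 2]]. *)
pose y := Num.min M (Num.max m x).
have yE : [/\ m <= y, y <= M & `|x - y| <= 2].
  rewrite /y ler_norml; have [h1|h1] := leP m x.
    by have [h2|h2] := leP M x; split; lra.
  by have [h2|h2] := leP M m; split; lra.
have [my yM xy] := yE.
have [t ft] : exists t : R, f (to_circle t) = y by apply: (circle_IVT hf fm fM); rewrite my yM.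
have -> : x = y + (x - y) by ring.
apply: spectrum_schrodinger_sup => // e L e0.
rewrite -ft; apply: (block_dense_circle hf (g := fun n => alpha * n.+1%:R `^ rho)) => //.
exact: block_dense_powR.
Qed.
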